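(* There exists a data structure supporting the following procedures: (1) $\textsc{Init}(\{M_1,\ldots,M_m\}\subseteq\mathbb{R}^{d\times d})$: takes a sequence of matrices $M_1,\ldots,M_m$ as input and preprocesses in time $O(\sum_{i=1}^m\mathrm{nnz}(M_i))$; (2) $\textsc{QueryPositiveSearch}(A\in\mathbb{R}^{d\times d})$: given a matrix $A$ with the promise that $\sum_{i=1}^m\langle M_i,A\rangle>0$, returns an index $i$ such that $\langle M_i,A\rangle>0$, in time $O(d^2\log m)$.
   Context: For matrices $A,B\in\mathbb{R}^{d\times d}$, $\langle A,B\rangle=\mathrm{tr}[A^\top B]=\sum_{j,k}A_{jk}B_{jk}$. $\mathrm{nnz}(M)$ denotes the number of nonzero entries of $M$. *)

(* Defs.v *)
From mathcomp Require Import all_boot all_order all_algebra.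
From mathcomp Require Import reals.

Set Implicit Arguments.
Unset Strict Implicit.
Unset Printing Implicit Defensive.

Import Order.TTheory GRing.Theory Num.Theory.

Local Open Scope ring_scope.

Definition mxinner (R : realType) (d : nat) (A B : 'M[R]_d) : R :=
  \tr (A^T *m B).

Definition nnz (R : realType) (d : nat) (A : 'M[R]_d) : nat :=
  #|[set p : 'I_d * 'I_d | A p.1 p.2 != 0]|.

(* The model of computation is a real RAM, presented as a structured language.
   A program uses finitely many integer and real registers and finitely many
   integer and real arrays, all named by natural numbers.  Programs contain no
   real constants besides numerals, and a real can never be converted to an
   integer (no floor), so reals cannot be used to pack information.
   Integers are machine words: computing an integer larger than the capacity W
   blocks execution, so integers cannot be used to pack information either. *)

Inductive iexp : Type :=
  | IConst of nat
  | IReg of nat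
  | IGet of nat & iexp              (* array name, position *)
  | IAdd of iexp & iexp
  | ISub of iexp & iexp             (* truncated *)
  | IMul of iexp & iexp
  | IDiv of iexp & iexp.            (* Euclidean quotient *)

Inductive rexp : Type :=
  | RConst of nat
  | RReg of nat
  | RGet of nat & iexp
  | RAdd of rexp & rexp
  | RSub of rexp & rexp
  | RMul of rexp & rexp
  | RDiv of rexp & rexp.

Inductive bexp : Type :=
  | ILt of iexp & iexp
  | RLt of rexp & rexp
  | BNot of bexp
  | BAnd of bexp & bexp.

Inductive cmd : Type :=
  | Skip
  | ISetReg of nat & iexp
  | RSetReg of nat & rexp
  | ISetArr of nat & iexp & iexp    (* array name, position, value *)
  | RSetArr of nat & iexp & rexp
  | Seq of cmd & cmd
  | If of bexp & cmd & cmd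
  | While of bexp & cmd.

Record state (R : realType) : Type := State {
  ireg : nat -> nat;
  rreg : nat -> R;
  iarr : nat -> nat -> nat;
  rarr : nat -> nat -> R
}.

Definition upd (T : Type) (f : nat -> T) (x : nat) (v : T) : nat -> T :=
  fun y => if y == x then v else f y.

Definition set_ireg (R : realType) (s : state R) (x v : nat) : state R :=
  State (upd (ireg s) x v) (rreg s) (iarr s) (rarr s).

Definition set_rreg (R : realType) (s : state R) (x : nat) (v : R) : state R :=
  State (ireg s) (upd (rreg s) x v) (iarr s) (rarr s).

Definition set_iarr (R : realType) (s : state R) (a p v : nat) : state R :=
  State (ireg s) (rreg s) (upd (iarr s) a (upd (iarr s a) p v)) (rarr s).

Definition set_rarr (R : realType) (s : state R) (a p : nat) (v : R) :
    state R :=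
  State (ireg s) (rreg s) (iarr s) (upd (rarr s) a (upd (rarr s a) p v)).

(* Evaluation returns None on word overflow and on real division by zero. *)

Definition word (W n : nat) : option nat := if (n <= W)%N then Some n else None.

Definition lift2 (T U : Type) (f : T -> T -> option U) (x y : option T) :
    option U :=
  obind (fun a => obind (f a) y) x.

Fixpoint ieval (R : realType) (W : nat) (s : state R) (e : iexp) : option nat :=
  match e with
  | IConst n => word W n
  | IReg x => Some (ireg s x)
  | IGet a e1 => omap (iarr s a) (ieval W s e1)
  | IAdd e1 e2 =>
      lift2 (fun x y => word W (x + y)) (ieval W s e1) (ieval W s e2)
  | ISub e1 e2 =>
      lift2 (fun x y => word W (x - y)) (ieval W s e1) (ieval W s e2)
  | IMul e1 e2 =>
      lift2 (fun x y => word W (x * y)) (ieval W s e1) (ieval W s e2)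
  | IDiv e1 e2 =>
      lift2 (fun x y => word W (x %/ y)) (ieval W s e1) (ieval W s e2)
  end.

Fixpoint reval (R : realType) (W : nat) (s : state R) (e : rexp) : option R :=
  match e with
  | RConst n => Some n%:R
  | RReg x => Some (rreg s x)
  | RGet a e1 => omap (rarr s a) (ieval W s e1)
  | RAdd e1 e2 =>
      lift2 (fun x y => Some (x + y)) (reval W s e1) (reval W s e2)
  | RSub e1 e2 =>
      lift2 (fun x y => Some (x - y)) (reval W s e1) (reval W s e2)
  | RMul e1 e2 =>
      lift2 (fun x y => Some (x * y)) (reval W s e1) (reval W s e2)
  | RDiv e1 e2 =>
      lift2 (fun x y => if y == 0 then None else Some (x / y))
            (reval W s e1) (reval W s e2)
  end.

Fixpoint beval (R : realType) (W : nat) (s : state R) (b : bexp) : option bool :=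
  match b with
  | ILt e1 e2 =>
      lift2 (fun x y : nat => Some (x < y)%N) (ieval W s e1) (ieval W s e2)
  | RLt e1 e2 =>
      lift2 (fun x y : R => Some (x < y)) (reval W s e1) (reval W s e2)
  | BNot b1 => omap negb (beval W s b1)
  | BAnd b1 b2 =>
      lift2 (fun x y => Some (x && y)) (beval W s b1) (beval W s b2)
  end.

(* Unit cost for every constant, register or array access, arithmetic
   operation, comparison and Boolean connective. *)

Fixpoint icost (e : iexp) : nat :=
  match e with
  | IConst _ | IReg _ => 1
  | IGet _ e1 => (icost e1).+1
  | IAdd e1 e2 | ISub e1 e2 | IMul e1 e2 | IDiv e1 e2 =>
      (icost e1 + icost e2).+1
  end.

Fixpoint rcost (e : rexp) : nat :=
  match e with
  | RConst _ | RReg _ => 1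
  | RGet _ e1 => (icost e1).+1
  | RAdd e1 e2 | RSub e1 e2 | RMul e1 e2 | RDiv e1 e2 =>
      (rcost e1 + rcost e2).+1
  end.

Fixpoint bcost (b : bexp) : nat :=
  match b with
  | ILt e1 e2 => (icost e1 + icost e2).+1
  | RLt e1 e2 => (rcost e1 + rcost e2).+1
  | BNot b1 => (bcost b1).+1
  | BAnd b1 b2 => (bcost b1 + bcost b2).+1
  end.

(* exec W c s t s' : on a machine with word capacity W, the program c started
   in s terminates without error in s' after exactly t time units. *)
Inductive exec (R : realType) (W : nat) :
    cmd -> state R -> nat -> state R -> Prop :=
  | ExecSkip s : exec W Skip s 1 s
  | ExecISetReg x e s v :
      ieval W s e = Some v ->
      exec W (ISetReg x e) s (icost e).+1 (set_ireg s x v)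
  | ExecRSetReg x e s v :
      reval W s e = Some v ->
      exec W (RSetReg x e) s (rcost e).+1 (set_rreg s x v)
  | ExecISetArr a e1 e2 s p v :
      ieval W s e1 = Some p -> ieval W s e2 = Some v ->
      exec W (ISetArr a e1 e2) s (icost e1 + icost e2).+1 (set_iarr s a p v)
  | ExecRSetArr a e1 e2 s p v :
      ieval W s e1 = Some p -> reval W s e2 = Some v ->
      exec W (RSetArr a e1 e2) s (icost e1 + rcost e2).+1 (set_rarr s a p v)
  | ExecSeq c1 c2 s1 s2 s3 t1 t2 :
      exec W c1 s1 t1 s2 -> exec W c2 s2 t2 s3 ->
      exec W (Seq c1 c2) s1 (t1 + t2) s3
  | ExecIf b c1 c2 s s' t v :
      beval W s b = Some v ->
      exec W (if v then c1 else c2) s t s' ->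
      exec W (If b c1 c2) s (bcost b + t).+1 s'
  | ExecWhileStop b c s :
      beval W s b = Some false ->
      exec W (While b c) s (bcost b).+1 s
  | ExecWhileStep b c s1 s2 s3 t1 t2 :
      beval W s1 b = Some true ->
      exec W c s1 t1 s2 -> exec W (While b c) s2 t2 s3 ->
      exec W (While b c) s1 (bcost b + t1 + t2).+1 s3.

(* Sparse (coordinate) representation of M_0, ..., M_(m-1): the positions of
   all nonzero entries, each listed once, matrix after matrix; the order inside
   one matrix is unspecified. *)
Definition sparse_repr (R : realType) (m d : nat) (M : 'I_m -> 'M[R]_d)
    (es : seq ('I_m * ('I_d * 'I_d))) : Prop :=
  [/\ uniq es,
      forall x, (x \in es) = (M x.1 x.2.1 x.2.2 != 0)
    & sorted (fun x y : 'I_m * ('I_d * 'I_d) => (x.1 <= y.1)%N) es].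

(* Registers and arrays outside the input area may hold anything at start. *)
Definition init_input (R : realType) (m d : nat) (M : 'I_m -> 'M[R]_d)
    (es : seq ('I_m * ('I_d * 'I_d))) (s : state R) : Prop :=
  [/\ ireg s 0 = m, ireg s 1 = d & ireg s 2 = size es] /\
  [/\ mkseq (iarr s 0) (size es) = [seq nat_of_ord x.1 | x <- es],
      mkseq (iarr s 1) (size es) = [seq nat_of_ord x.2.1 | x <- es],
      mkseq (iarr s 2) (size es) = [seq nat_of_ord x.2.2 | x <- es]
    & mkseq (rarr s 0) (size es) = [seq M x.1 x.2.1 x.2.2 | x <- es]].

(* s is s0 after the caller has put the query matrix A, dense and in row-major
   order, into real array 1. *)
Definition query_input (R : realType) (d : nat) (A : 'M[R]_d)
    (s0 s : state R) : Prop :=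
  [/\ ireg s = ireg s0, rreg s = rreg s0, iarr s = iarr s0,
      forall a, a != 1%N -> rarr s a = rarr s0 a
    & forall j k : 'I_d, rarr s 1 (j * d + k)%N = A j k].

Definition query_output (R : realType) (s : state R) : nat := ireg s 0.

(* Main.v *)
Require Import Defs.
From mathcomp Require Import all_boot all_order all_algebra.
From mathcomp Require Import reals.
From mathcomp Require Import zify.

Set Implicit Arguments.
Unset Strict Implicit.
Unset Printing Implicit Defensive.

Import Order.TTheory GRing.Theory Num.Theory.

Local Open Scope ring_scope.

(* The entries of M_0, ..., M_(m-1) form one list, and a matrix is an interval of
   it.  Cut the list at boundaries between matrices into chunks of at least d^2
   and at most 2 d^2 entries (the last one may be shorter), and store the dense
   sum of all the entries before each cut.  There are at most N / d^2 cuts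
   besides the first, so saving d^2 numbers per cut takes time O(N) in all; if
   N < d^2 nothing is done beyond recording that there is a single chunk.
   Let F(b) be the inner product with A of the sum of the entries before b.
   Initially F(0) = 0 < F(N), and whenever F(b) < F(b'), any b'' in between
   satisfies F(b) < F(b'') or F(b'') < F(b'); so a binary search over the cuts,
   each step a dense inner product, finds a chunk on which F increases, and the
   value of F at the right end is never needed.  Some matrix of that chunk has a
   positive inner product with A, and a linear scan of the chunk finds it. *)

(** * Time-credit logic *)

Arguments upd T f x v y /.

(** Evaluation is split into a total value and a separate proposition that no word overflows, so
    that the rules below leave plain arithmetic goals. *)
Fixpoint ival (R : realType) (s : state R) (e : iexp) : nat :=
  match e with
  | IConst n => n
  | IReg x => ireg s x
  | IGet a e1 => iarr s a (ival s e1)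
  | IAdd e1 e2 => ival s e1 + ival s e2
  | ISub e1 e2 => ival s e1 - ival s e2
  | IMul e1 e2 => ival s e1 * ival s e2
  | IDiv e1 e2 => ival s e1 %/ ival s e2
  end.

Fixpoint ifits (R : realType) (W : nat) (s : state R) (e : iexp) : Prop :=
  match e with
  | IConst n => (n <= W)%N
  | IReg x => True
  | IGet a e1 => ifits W s e1
  | IAdd e1 e2 =>
      [/\ ifits W s e1, ifits W s e2 & (ival s e1 + ival s e2 <= W)%N]
  | ISub e1 e2 =>
      [/\ ifits W s e1, ifits W s e2 & (ival s e1 - ival s e2 <= W)%N]
  | IMul e1 e2 =>
      [/\ ifits W s e1, ifits W s e2 & (ival s e1 * ival s e2 <= W)%N]
  | IDiv e1 e2 =>
      [/\ ifits W s e1, ifits W s e2 & (ival s e1 %/ ival s e2 <= W)%N]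
  end.

Lemma ieval_fits (R : realType) W (s : state R) e :
  ifits W s e -> ieval W s e = Some (ival s e).
Proof.
have word_fits k : (k <= W)%N -> word W k = Some k by rewrite /word => ->.
elim: e => //= [a e IH|e1 IH1 e2 IH2|e1 IH1 e2 IH2|e1 IH1 e2 IH2|e1 IH1 e2 IH2].
  by move=> /IH ->.
all: by case=> /IH1 -> /IH2 ->; apply: word_fits.
Qed.

Fixpoint rval (R : realType) (s : state R) (e : rexp) : R :=
  match e with
  | RConst n => n%:R
  | RReg x => rreg s x
  | RGet a e1 => rarr s a (ival s e1)
  | RAdd e1 e2 => rval s e1 + rval s e2
  | RSub e1 e2 => rval s e1 - rval s e2
  | RMul e1 e2 => rval s e1 * rval s e2
  | RDiv e1 e2 => rval s e1 / rval s e2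
  end.

Fixpoint rfits (R : realType) (W : nat) (s : state R) (e : rexp) : Prop :=
  match e with
  | RConst _ | RReg _ => True
  | RGet a e1 => ifits W s e1
  | RAdd e1 e2 | RSub e1 e2 | RMul e1 e2 => rfits W s e1 /\ rfits W s e2
  | RDiv e1 e2 => [/\ rfits W s e1, rfits W s e2 & rval s e2 != 0]
  end.

Lemma reval_fits (R : realType) W (s : state R) e :
  rfits W s e -> reval W s e = Some (rval s e).
Proof.
elim: e => //= [a e /ieval_fits -> //|e1 IH1 e2 IH2|e1 IH1 e2 IH2|e1 IH1 e2 IH2|
               e1 IH1 e2 IH2].
4: by case=> /IH1 -> /IH2 -> /negPf /= ->.
all: by case=> /IH1 -> /IH2 ->.
Qed.

Fixpoint bval (R : realType) (s : state R) (b : bexp) : bool :=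
  match b with
  | ILt e1 e2 => (ival s e1 < ival s e2)%N
  | RLt e1 e2 => rval s e1 < rval s e2
  | BNot b1 => ~~ bval s b1
  | BAnd b1 b2 => bval s b1 && bval s b2
  end.

Fixpoint bfits (R : realType) (W : nat) (s : state R) (b : bexp) : Prop :=
  match b with
  | ILt e1 e2 => ifits W s e1 /\ ifits W s e2
  | RLt e1 e2 => rfits W s e1 /\ rfits W s e2
  | BNot b1 => bfits W s b1
  | BAnd b1 b2 => bfits W s b1 /\ bfits W s b2
  end.

Lemma beval_fits (R : realType) W (s : state R) b :
  bfits W s b -> beval W s b = Some (bval s b).
Proof.
elim: b => /= [e1 e2|e1 e2|b IH|b1 IH1 b2 IH2].
- by case=> /ieval_fits -> /ieval_fits ->.
- by case=> /reval_fits -> /reval_fits ->.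
- by move=> /IH ->.
by case=> /IH1 -> /IH2 ->.
Qed.

(* Weakest precondition with time credits: [n] credits are available in [s],
   and the postcondition sees the credits that are left. *)
Definition wp (R : realType) (W : nat) (c : cmd)
    (Q : nat -> state R -> Prop) (n : nat) (s : state R) : Prop :=
  exists t s', [/\ exec W c s t s', (t <= n)%N & Q (n - t)%N s'].

Section Wp.
Variables (R : realType) (W : nat).
Implicit Types (Q : nat -> state R -> Prop) (s : state R).

Lemma wp_mono c Q Q' n s :
  (forall k s', Q k s' -> Q' k s') -> wp W c Q n s -> wp W c Q' n s.
Proof. by move=> QQ' [t [s' [ex le_tn /QQ' Qs']]]; exists t, s'. Qed.

Lemma wp_skip Q n s : (0 < n)%N -> Q (n - 1)%N s -> wp W Skip Q n s.
Proof. by move=> n0 Qs; exists 1%N, s; split=> //; apply: ExecSkip. Qed.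

Lemma wp_ireg x e Q n s :
  ifits W s e -> (icost e < n)%N ->
  Q (n - (icost e).+1)%N (set_ireg s x (ival s e)) -> wp W (ISetReg x e) Q n s.
Proof.
move=> fits lt_n Qs; exists (icost e).+1, (set_ireg s x (ival s e)).
by split=> //; apply/ExecISetReg/ieval_fits.
Qed.

Lemma wp_rreg x e Q n s :
  rfits W s e -> (rcost e < n)%N ->
  Q (n - (rcost e).+1)%N (set_rreg s x (rval s e)) -> wp W (RSetReg x e) Q n s.
Proof.
move=> fits lt_n Qs; exists (rcost e).+1, (set_rreg s x (rval s e)).
by split=> //; apply/ExecRSetReg/reval_fits.
Qed.

Lemma wp_iarr a e1 e2 Q n s :
  ifits W s e1 -> ifits W s e2 -> (icost e1 + icost e2 < n)%N ->
  Q (n - (icost e1 + icost e2).+1)%N (set_iarr s a (ival s e1) (ival s e2)) ->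
  wp W (ISetArr a e1 e2) Q n s.
Proof.
move=> fits1 fits2 lt_n Qs.
exists (icost e1 + icost e2).+1, (set_iarr s a (ival s e1) (ival s e2)).
by split=> //; apply/ExecISetArr; apply: ieval_fits.
Qed.

Lemma wp_rarr a e1 e2 Q n s :
  ifits W s e1 -> rfits W s e2 -> (icost e1 + rcost e2 < n)%N ->
  Q (n - (icost e1 + rcost e2).+1)%N (set_rarr s a (ival s e1) (rval s e2)) ->
  wp W (RSetArr a e1 e2) Q n s.
Proof.
move=> fits1 fits2 lt_n Qs.
exists (icost e1 + rcost e2).+1, (set_rarr s a (ival s e1) (rval s e2)).
by split=> //; apply/ExecRSetArr; [apply: ieval_fits|apply: reval_fits].
Qed.

Lemma wp_seq c1 c2 Q n s : wp W c1 (wp W c2 Q) n s -> wp W (Seq c1 c2) Q n s.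
Proof.
case=> t1 [s1 [ex1 le1 [t2 [s2 [ex2 le2 Qs]]]]].
exists (t1 + t2)%N, s2; split; last by rewrite subnDA.
  exact: ExecSeq ex1 ex2.
by rewrite -leq_subRL.
Qed.

Lemma wp_if b c1 c2 Q n s :
  bfits W s b -> (bcost b < n)%N ->
  (bval s b -> wp W c1 Q (n - (bcost b).+1) s) ->
  (~~ bval s b -> wp W c2 Q (n - (bcost b).+1) s) ->
  wp W (If b c1 c2) Q n s.
Proof.
move=> fits lt_n wp1 wp2.
have [t [s' [ex le_t Qs]]] :
    wp W (if bval s b then c1 else c2) Q (n - (bcost b).+1) s.
  by case: (bval s b) wp1 wp2 => [/(_ isT)|_ /(_ isT)].
exists (bcost b + t).+1, s'; split; last by rewrite -addSn subnDA.
  by apply: ExecIf ex; apply: beval_fits.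
by rewrite -addSn -leq_subRL.
Qed.

(** The credits serve as the variant: each test of the guard consumes at least one, so strong
    induction on them gives termination. *)
Lemma wp_while (I : nat -> state R -> Prop) b c Q n s :
  (forall k s', I k s' ->
     [/\ bfits W s' b, (bcost b < k)%N,
         bval s' b -> wp W c I (k - (bcost b).+1) s'
       & ~~ bval s' b -> Q (k - (bcost b).+1)%N s']) ->
  I n s -> wp W (While b c) Q n s.
Proof.
move=> step; elim/ltn_ind: n s => n IH s Is.
have [fits lt_n body stop] := step _ _ Is.
have [vb|vb] := boolP (bval s b).
  have [t1 [s1 [ex1 le1 I1]]] := body vb.
  have [|t2 [s2 [ex2 le2 Q2]]] := IH (n - (bcost b).+1 - t1)%N _ s1 I1.
    by lia.
  exists (bcost b + t1 + t2).+1, s2; split.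
  - by apply: ExecWhileStep ex1 ex2; rewrite beval_fits // vb.
  - by lia.
  - by rewrite -!addSn !subnDA.
exists (bcost b).+1, s; split=> //; last exact: stop.
by apply: ExecWhileStop; rewrite beval_fits // (negbTE vb).
Qed.

End Wp.

(** * The programs *)

Definition incr (x : nat) : cmd := ISetReg x (IAdd (IReg x) (IConst 1)).

(* Registers: 1 dimension d, 2 number N of entries, 3 number of chunks,
   4 current entry, 5 loop counter, 6 first entry at which the next cut is
   allowed, 7 d * d.  Integer array 3 holds the cuts, real array 3 the dense
   sum of the entries read so far, and block k of real array 2 the value of
   that sum at cut k. *)
Definition zero_prefix : cmd :=
  Seq (ISetReg 5 (IConst 0))
      (While (ILt (IReg 5) (IReg 7))
         (Seq (RSetArr 3 (IReg 5) (RConst 0)) (incr 5))).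

Definition save_prefix : cmd :=
  Seq (ISetReg 5 (IConst 0))
      (While (ILt (IReg 5) (IReg 7))
         (Seq (RSetArr 2 (IAdd (IMul (IReg 3) (IReg 7)) (IReg 5))
                 (RGet 3 (IReg 5)))
              (incr 5))).

Definition cut_here : cmd :=
  Seq (ISetArr 3 (IReg 3) (IReg 4))
 (Seq save_prefix
 (Seq (incr 3)
      (ISetReg 6 (IAdd (IReg 4) (IReg 7))))).

Definition entry_pos : iexp :=
  IAdd (IMul (IGet 1 (IReg 4)) (IReg 1)) (IGet 2 (IReg 4)).

(** [BAnd] evaluates both sides, so this test also runs at entry 0; truncated subtraction then
    compares that entry with itself. *)
Definition new_matrix : bexp :=
  ILt (IGet 0 (ISub (IReg 4) (IConst 1))) (IGet 0 (IReg 4)).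

(** Cutting precedes the addition, so the saved sum covers exactly the entries before the cut. *)
Definition scan_entry : cmd :=
  Seq (If (BAnd (BNot (ILt (IReg 4) (IReg 6))) new_matrix) cut_here Skip)
 (Seq (RSetArr 3 entry_pos (RAdd (RGet 3 entry_pos) (RGet 0 (IReg 4))))
      (incr 4)).

Definition init_prog : cmd :=
  Seq (ISetReg 7 (IMul (IReg 1) (IReg 1)))
 (Seq (ISetArr 3 (IConst 0) (IConst 0))
 (Seq (ISetReg 3 (IConst 1))
 (Seq (If (ILt (IReg 2) (IReg 7))
          Skip
          (Seq zero_prefix
          (Seq (ISetReg 4 (IConst 0))
          (Seq (ISetReg 6 (IReg 7))
               (While (ILt (IReg 4) (IReg 2)) scan_entry)))))
      (ISetArr 3 (IReg 3) (IReg 2))))).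

(* Registers: 8 and 9 the cuts enclosing the search, 10 the middle cut;
   real registers: 0 the accumulator, 1 the value of the prefix sum at the
   left cut. *)
Definition eval_prefix : cmd :=
  Seq (RSetReg 0 (RConst 0))
 (Seq (ISetReg 5 (IConst 0))
      (While (ILt (IReg 5) (IReg 7))
         (Seq (RSetReg 0 (RAdd (RReg 0)
                 (RMul (RGet 2 (IAdd (IMul (IReg 10) (IReg 7)) (IReg 5)))
                       (RGet 1 (IReg 5)))))
              (incr 5)))).

Definition bisect_step : cmd :=
  Seq (ISetReg 10 (IDiv (IAdd (IReg 8) (IReg 9)) (IConst 2)))
 (Seq eval_prefix
      (If (RLt (RReg 1) (RReg 0))
          (ISetReg 9 (IReg 10))
          (Seq (ISetReg 8 (IReg 10)) (RSetReg 1 (RReg 0))))).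

Definition bisect : cmd :=
  While (ILt (IAdd (IReg 8) (IConst 1)) (IReg 9)) bisect_step.

(** The counter advances before the boundary test, so the test looks at the next entry and the
    answer is read one position back. *)
Definition search_step : cmd :=
  Seq (RSetReg 0 (RAdd (RReg 0)
         (RMul (RGet 0 (IReg 4)) (RGet 1 entry_pos))))
 (Seq (incr 4)
      (If (BAnd (ILt (IReg 4) (IReg 5)) (BNot new_matrix))
          Skip
          (Seq (If (RLt (RConst 0) (RReg 0))
                   (ISetReg 0 (IGet 0 (ISub (IReg 4) (IConst 1))))
                   Skip)
               (RSetReg 0 (RConst 0))))).

Definition search : cmd :=
  Seq (ISetReg 4 (IGet 3 (IReg 8)))
 (Seq (ISetReg 5 (IGet 3 (IReg 9)))
 (Seq (RSetReg 0 (RConst 0))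
      (While (ILt (IReg 4) (IReg 5)) search_step))).

Definition query_prog : cmd :=
  Seq (ISetReg 7 (IMul (IReg 1) (IReg 1)))
 (Seq (ISetReg 8 (IConst 0))
 (Seq (ISetReg 9 (IReg 3))
 (Seq (RSetReg 1 (RConst 0))
 (Seq bisect search)))).

(** * Loops over one dense block *)

Definition agree_off (T : Type) (x : nat) (f g : nat -> T) : Prop :=
  forall y, y != x -> f y = g y.

Lemma agree_off_upd (T : Type) x v (f g : nat -> T) :
  agree_off x f g -> agree_off x (upd f x v) g.
Proof. by move=> fg y ne_yx; rewrite /= (negbTE ne_yx) fg. Qed.

(** The constants are exact costs: 4 for the guard, 3 for the store and 4 for the increment per
    round; 6 for the initialisation and the last test. The next two loops are counted likewise. *)
Lemma wp_zero_prefix (R : realType) W Q n (s : state R) :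
  (ireg s 7 < W)%N -> (11 * ireg s 7 + 6 <= n)%N ->
  (forall k s', (n <= k + 11 * ireg s 7 + 6)%N ->
     agree_off 5 (ireg s') (ireg s) -> iarr s' = iarr s ->
     agree_off 3 (rarr s') (rarr s) ->
     (forall q, (q < ireg s 7)%N -> rarr s' 3 q = 0) -> Q k s') ->
  wp W zero_prefix Q n s.
Proof.
move=> ltW le_n post; apply/wp_seq/wp_ireg => //=; first lia.
refine (wp_while (I := fun k (s' : state R) =>
  [/\ (ireg s' 5 <= ireg s 7)%N, (n <= k + 11 * ireg s' 5 + 2)%N,
      agree_off 5 (ireg s') (ireg s) /\ iarr s' = iarr s,
      agree_off 3 (rarr s') (rarr s)
    & forall q, (q < ireg s' 5)%N -> rarr s' 3 q = 0]) _ _); last first.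
  by split=> //=; [lia|split=> //; apply: agree_off_upd].
move=> k s' [le5 kn [eqi eqa] eqr z]; have eq7 := eqi 7%N isT.
split=> //=; first lia; last first.
  rewrite eq7 -leqNgt => ge5; apply: post => //; first lia.
  by move=> q lt; apply: z; lia.
rewrite eq7 => lt5.
apply/wp_seq/wp_rarr => //=; first lia.
apply: wp_ireg => /=; first by split=> //; lia.
  lia.
split=> /=; [lia|lia| | |] => [|| q lt].
- by split=> //; apply: agree_off_upd.
- exact: agree_off_upd.
by case: eqP => // ne; apply: z; lia.
Qed.

Lemma wp_save_prefix (R : realType) W Q n (s : state R) :
  (ireg s 3 * ireg s 7 + ireg s 7 < W)%N -> (16 * ireg s 7 + 6 <= n)%N ->
  (forall k s', (n <= k + 16 * ireg s 7 + 6)%N ->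
     agree_off 5 (ireg s') (ireg s) -> iarr s' = iarr s ->
     agree_off 2 (rarr s') (rarr s) ->
     (forall x, (x < ireg s 3 * ireg s 7)%N -> rarr s' 2 x = rarr s 2 x) ->
     (forall q, (q < ireg s 7)%N ->
        rarr s' 2 (ireg s 3 * ireg s 7 + q)%N = rarr s 3 q) -> Q k s') ->
  wp W save_prefix Q n s.
Proof.
move=> ltW le_n post; apply/wp_seq/wp_ireg => //=; first lia.
refine (wp_while (I := fun k (s' : state R) =>
  [/\ (ireg s' 5 <= ireg s 7)%N, (n <= k + 16 * ireg s' 5 + 2)%N,
      agree_off 5 (ireg s') (ireg s) /\ iarr s' = iarr s,
      agree_off 2 (rarr s') (rarr s)
    & (forall x, (x < ireg s 3 * ireg s 7)%N -> rarr s' 2 x = rarr s 2 x) /\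
      forall q, (q < ireg s' 5)%N ->
        rarr s' 2 (ireg s 3 * ireg s 7 + q)%N = rarr s 3 q]) _ _); last first.
  by split=> //=; [lia|split=> //; apply: agree_off_upd].
move=> k s' [le5 kn [eqi eqa] eqr [old new]].
have eq7 := eqi 7%N isT; have eq3 := eqi 3%N isT.
split=> //=; first lia; last first.
  rewrite eq7 -leqNgt => ge5; apply: post => //; first lia.
  by move=> q lt; apply: new; lia.
rewrite eq7 => lt5.
apply/wp_seq/wp_rarr => //=.
- by split; [split=> //; rewrite ?eq3 ?eq7; lia| |rewrite ?eq3 ?eq7; lia].
- lia.
apply: wp_ireg => /=; first by split=> //; lia.
  lia.
split=> /=; [lia|lia| | |].
- by split=> //; apply: agree_off_upd.
- exact: agree_off_upd.
rewrite eq3 eq7; split=> [x lt|q lt].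
  by case: eqP => [|_]; [lia|apply: old].
case: eqP => [e|ne].
  have -> : q = ireg s' 5 by lia.
  by apply: (f_equal (fun f => f _)); apply: eqr.
by apply: new; lia.
Qed.

Lemma wp_eval_prefix (R : realType) W Q n (s : state R) :
  (ireg s 10 * ireg s 7 + ireg s 7 < W)%N -> (20 * ireg s 7 + 8 <= n)%N ->
  (forall k s', (n <= k + 20 * ireg s 7 + 8)%N ->
     agree_off 5 (ireg s') (ireg s) -> iarr s' = iarr s ->
     rarr s' = rarr s -> agree_off 0 (rreg s') (rreg s) ->
     rreg s' 0 = \sum_(0 <= q < ireg s 7)
                   rarr s 2 (ireg s 10 * ireg s 7 + q)%N * rarr s 1 q ->
     Q k s') ->
  wp W eval_prefix Q n s.
Proof.
move=> ltW le_n post.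
apply/wp_seq/wp_rreg => //=; first lia.
apply/wp_seq/wp_ireg => //=; first lia.
refine (wp_while (I := fun k (s' : state R) =>
  [/\ (ireg s' 5 <= ireg s 7)%N, (n <= k + 20 * ireg s' 5 + 4)%N,
      agree_off 5 (ireg s') (ireg s) /\ iarr s' = iarr s,
      rarr s' = rarr s /\ agree_off 0 (rreg s') (rreg s)
    & rreg s' 0 = \sum_(0 <= q < ireg s' 5)
                   rarr s 2 (ireg s 10 * ireg s 7 + q)%N * rarr s 1 q]) _ _);
  last first.
  split=> //=; first lia.
  - by split=> //; apply: agree_off_upd.
  - by split=> //; apply: agree_off_upd.
  - by rewrite big_geq.
move=> k s' [le5 kn [eqi eqa] [eqr eqrr] acc].
have eq7 := eqi 7%N isT; have eq10 := eqi 10%N isT.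
split=> //=; first lia; last first.
  rewrite eq7 -leqNgt => ge5; apply: post => //; first lia.
  by rewrite acc; have -> : ireg s' 5 = ireg s 7 by lia.
rewrite eq7 => lt5.
apply/wp_seq/wp_rreg => /=.
- split=> //; split=> //.
  by split; [split=> //; rewrite eq10 eq7; lia| |rewrite eq10 eq7; lia].
- lia.
apply: wp_ireg => /=; first by split=> //; lia.
  lia.
split=> /=; [lia|lia| | |].
- by split=> //; apply: agree_off_upd.
- by split=> //; apply: agree_off_upd.
by rewrite eq10 eq7 eqr acc addn1 big_nat_recr.
Qed.

(** * Cutting the list of entries into chunks *)

(* Entry [p] of the input lies in matrix [ix p], at row [rw p] and column
   [cl p]; the last field holds because a matrix has at most d * d entries. *)
Record layout (N d : nat) (ix rw cl : nat -> nat) : Prop := Layout {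
  layout_mono : forall p q, (p <= q < N)%N -> (ix p <= ix q)%N;
  layout_row : forall p, (p < N)%N -> (rw p < d)%N;
  layout_col : forall p, (p < N)%N -> (cl p < d)%N;
  layout_run : forall p q, (p <= q < N)%N -> ix p = ix q -> (q - p < d * d)%N
}.

Definition flat (d : nat) (rw cl : nat -> nat) (p : nat) : nat :=
  (rw p * d + cl p)%N.

Lemma flat_lt N d ix rw cl p :
  layout N d ix rw cl -> (p < N)%N -> (flat d rw cl p < d * d)%N.
Proof.
move=> lay lt_pN; have := layout_row lay lt_pN; have := layout_col lay lt_pN.
by rewrite /flat; nia.
Qed.

(** Quantifying over all pairs across [b], not only its two neighbours, makes [0] and [N] boundaries
    without a special case. *)
Definition aligned (N : nat) (ix : nat -> nat) (b : nat) : Prop :=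
  forall p q, (p < b <= q)%N -> (q < N)%N -> (ix p < ix q)%N.

Lemma aligned0 N ix : aligned N ix 0.
Proof. by []. Qed.

Lemma aligned_end N ix : aligned N ix N.
Proof. by move=> p q; lia. Qed.

Lemma aligned_jump N d ix rw cl b :
  layout N d ix rw cl -> (0 < b)%N -> (ix (b - 1) < ix b)%N -> aligned N ix b.
Proof.
move=> lay b0 jump p q pbq qN.
have := layout_mono lay (p := p) (q := (b - 1)%N).
have := layout_mono lay (p := b) (q := q).
by lia.
Qed.

(** Coordinate [q] of the dense sum, flattened row by row, of the first [p] entries; different
    matrices may contribute to the same coordinate. *)
Definition prefix_entry (R : realType) (pos : nat -> nat) (vl : nat -> R)
    (p q : nat) : R :=
  \sum_(0 <= x < p | pos x == q) vl x.

Lemma prefix_entryS (R : realType) pos (vl : nat -> R) p q :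
  prefix_entry pos vl p.+1 q =
  prefix_entry pos vl p q + (if q == pos p then vl p else 0).
Proof.
rewrite /prefix_entry big_mkcond big_nat_recr //= -big_mkcond /=.
by rewrite (eq_sym q).
Qed.

(** After exchanging the sums, entry [x] survives only at [q = pos x]. This identifies the dense
    product of [eval_prefix] with a sum over entries. *)
Lemma prefix_entry_dot (R : realType) pos (vl a : nat -> R) D p :
  (forall x, (x < p)%N -> (pos x < D)%N) ->
  \sum_(0 <= q < D) prefix_entry pos vl p q * a q =
  \sum_(0 <= x < p) vl x * a (pos x).
Proof.
move=> posD.
under eq_bigr => q _ do rewrite /prefix_entry big_mkcond big_distrl /=.
rewrite exchange_big_nat /=; apply: eq_big_nat => x /andP[_ ltxp].
rewrite (bigD1_seq (pos x)) ?iota_uniq ?mem_index_iota ?posD //= eqxx.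
rewrite big1 ?addr0 // => q ne; by rewrite eq_sym (negbTE ne) mul0r.
Qed.

(* [K] cuts have been made so far: chunk [k] is the interval between cuts [k]
   and [k.+1].  Block 0 of [P], the zero matrix, is left unset. *)
Record chunked (R : realType) (N D : nat) (ix pos : nat -> nat)
    (vl : nat -> R) (K : nat) (b : nat -> nat) (P : nat -> R) : Prop :=
  Chunked {
    chunked_gt0 : (0 < K)%N;
    chunked_sparse : (K.-1 * D <= b K.-1)%N;
    chunked_start : b 0 = 0%N;
    chunked_aligned : forall k, (k < K)%N -> aligned N ix (b k);
    chunked_le : forall k, (k < K)%N -> (b k <= N)%N;
    chunked_size : forall k, (k.+1 < K)%N -> (b k <= b k.+1 <= b k + 2 * D)%N;
    chunked_prefix : forall k q, (0 < k < K)%N -> (q < D)%N ->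
      P (k * D + q)%N = prefix_entry pos vl (b k) q
  }.

(** The lower bound on [p] pays for the new cut in [chunked_sparse], the upper bound is the size of
    the chunk just closed, and blocks below [K] are untouched. *)
Lemma chunked_cut (R : realType) N D ix pos (vl : nat -> R) K b P P' p :
  chunked N D ix pos vl K b P ->
  aligned N ix p -> (b K.-1 + D <= p <= b K.-1 + 2 * D)%N -> (p <= N)%N ->
  (forall x, (x < K * D)%N -> P' x = P x) ->
  (forall q, (q < D)%N -> P' (K * D + q)%N = prefix_entry pos vl p q) ->
  chunked N D ix pos vl K.+1 (upd b K p) P'.
Proof.
move=> [K0 sp st al le sz pre] alp pb pN old new.
have K1 : K = K.-1.+1 by lia.
split=> //=.
- by rewrite eqxx; nia.
- by case: eqP => // /esym; lia.
- by move=> k; case: eqP => [//|ne] lt; apply: al; lia.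
- by move=> k; case: eqP => [//|ne] lt; apply: le; lia.
- move=> k lt; have [e|ne] := eqVneq k.+1 K.
    by rewrite -e (ltn_eqF (ltnSn k)) in pb *; rewrite /= in pb; lia.
  have -> : (k == K) = false by lia.
  by apply: sz; lia.
move=> k q kK lt; case: eqP => [-> //|ne]; first exact: new.
rewrite old; first by apply: pre; lia.
by have : (k.+1 <= K)%N by [lia]; nia.
Qed.

(** Index [K] lies outside every range constrained by [chunked]; the end [N] is stored there as a
    sentinel. *)
Lemma chunked_extend (R : realType) N D ix pos (vl : nat -> R) K b P v :
  chunked N D ix pos vl K b P -> chunked N D ix pos vl K (upd b K v) P.
Proof.
case=> K0 sp st al le sz pre.
have updE k : (k < K)%N -> upd b K v k = b k by move=> lt; rewrite /= ltn_eqF.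
split=> //.
- by rewrite updE //; lia.
- by rewrite updE.
- by move=> k lt; rewrite updE //; apply: al.
- by move=> k lt; rewrite updE //; apply: le.
- by move=> k lt; rewrite !updE //; [apply: sz|lia].
by move=> k q kK lt; rewrite updE; [apply: pre|lia].
Qed.

(** * Correctness and cost of the preprocessing *)

Definition input_frame (R : realType) (N d : nat) (s s' : state R) : Prop :=
  [/\ ireg s' 1 = d, ireg s' 2 = N, agree_off 3 (iarr s') (iarr s)
    & rarr s' 0 = rarr s 0].

Definition state_chunked (R : realType) (N d : nat) (s : state R) : Prop :=
  chunked N (d * d) (iarr s 0) (flat d (iarr s 1) (iarr s 2)) (rarr s 0)
    (ireg s 3) (iarr s 3) (rarr s 2).

Definition last_cut (R : realType) (s : state R) : nat :=
  iarr s 3 (ireg s 3).-1.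

Definition scanned (R : realType) (N d : nat) (s s' : state R) : Prop :=
  [/\ input_frame N d s s', ireg s' 7 = (d * d)%N /\
        ireg s' 6 = (last_cut s' + d * d)%N,
      (last_cut s' <= ireg s' 4 <= N)%N,
      state_chunked N d s'
    & forall q, (q < d * d)%N -> rarr s' 3 q =
        prefix_entry (flat d (iarr s 1) (iarr s 2)) (rarr s 0) (ireg s' 4) q].

Lemma wp_cut_here (R : realType) W N d Q n (s s1 : state R) :
  layout N d (iarr s 0) (iarr s 1) (iarr s 2) ->
  (2 * N + 3 * (d * d) + 3 <= W)%N ->
  scanned N d s s1 -> aligned N (iarr s 0) (ireg s1 4) ->
  (last_cut s1 + d * d <= ireg s1 4 <= last_cut s1 + 2 * (d * d))%N ->
  (ireg s1 4 < N)%N -> (33 * (d * d) <= n)%N ->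
  (forall k s2, (n <= k + 33 * (d * d))%N -> scanned N d s s2 ->
     last_cut s2 = ireg s1 4 -> ireg s2 4 = ireg s1 4 -> Q k s2) ->
  wp W cut_here Q n s1.
Proof.
move=> lay leW [[e1 e2 eqa eqr0] [e7 e6] pN ch pre] al sz lt_p le_n post.
(* The current entry forces [d * d >= 1], so the exact cost [16 * (d * d) + 17] is at most
   [33 * (d * d)]. *)
have d0 : (0 < d * d)%N by have := flat_lt lay lt_p; lia.
(* Sparsity of the cuts bounds their number and the addresses of their blocks, so these fit in a
   word. *)
have leK : (ireg s1 3 <= N + 1)%N.
  by have := chunked_sparse ch; rewrite -/(last_cut s1); nia.
have leKD : (ireg s1 3 * (d * d) <= N + d * d)%N.
  have := chunked_sparse ch; rewrite -/(last_cut s1); have := chunked_gt0 ch.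
  by case: (ireg s1 3) leK => // K _ _ /=; nia.
apply/wp_seq/wp_iarr => //=; first lia.
apply/wp_seq/wp_save_prefix => //=; rewrite ?e7; [lia|lia|].
move=> k s2 kn eqi ea er old new.
have ei3 : ireg s2 3 = ireg s1 3 by apply: eqi.
have ei4 : ireg s2 4 = ireg s1 4 by apply: eqi.
have ei7 : ireg s2 7 = ireg s1 7 by apply: eqi.
apply/wp_seq/wp_ireg => /=; first by split=> //; lia.
  lia.
apply: wp_ireg => /=; first by split=> //; lia.
  lia.
have ne (x y : nat) : x != y -> (x == y) = false by move/negbTE.
apply: post => /=.
- lia.
- split=> /=.
  + split=> /=.
    * by rewrite eqi.
    * by rewrite eqi.
    * by rewrite ea => a ne3 /=; rewrite (negbTE ne3); apply: eqa.
    * by rewrite er.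
  + split; first by rewrite ei7.
    by rewrite /last_cut /= ei3 addn1 /= ea /= eqxx ei4 ei7 e7.
  + by rewrite /last_cut /= ei3 addn1 /= ea /= eqxx ei4; lia.
  + rewrite /state_chunked /= ei3 addn1 ea /= er //.
    have -> : iarr s1 0 = iarr s 0 by apply: eqa.
    have -> : iarr s1 1 = iarr s 1 by apply: eqa.
    have -> : iarr s1 2 = iarr s 2 by apply: eqa.
    move: ch; rewrite /state_chunked.
    rewrite (eqa 0%N) // (eqa 1%N) // (eqa 2%N) // eqr0 => ch.
    apply: (chunked_cut ch) => //; first lia.
    by move=> q lt; rewrite new ?pre.
  + by move=> q lt; rewrite er // ei4; apply: pre.
- by rewrite /last_cut /= ei3 addn1 /= ea /= eqxx.
by rewrite ei4.
Qed.

Lemma wp_scan (R : realType) W N d Q n (s s1 : state R) :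
  layout N d (iarr s 0) (iarr s 1) (iarr s 2) ->
  (2 * N + 3 * (d * d) + 3 <= W)%N ->
  scanned N d s s1 -> ireg s1 4 = 0%N -> last_cut s1 = 0%N ->
  (74 * N + 4 <= n)%N ->
  (forall k s2, (n <= k + 74 * N + 4)%N -> scanned N d s s2 ->
     ireg s2 4 = N -> (N <= last_cut s2 + 2 * (d * d))%N -> Q k s2) ->
  wp W (While (ILt (IReg 4) (IReg 2)) scan_entry) Q n s1.
Proof.
move=> lay leW sc1 p1 last1 le_n post.
(* Either [p] is at most [d * d] past the last cut, or the entries from [last_cut + d * d - 1] to
   [p - 1] lie in one matrix. By [layout_run] the open chunk then has at most [2 * (d * d)]
   entries. *)
pose in_run (s' : state R) p := (p <= last_cut s' + d * d)%N \/
  iarr s 0 (last_cut s' + d * d - 1)%N = iarr s 0 (p - 1)%N.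
(* Besides the 41 credits per entry read, 33 credits per entry before the last
   cut account for the cuts: each of them is at least [d * d] entries after the
   previous one and costs at most [33 * (d * d)]. *)
refine (wp_while (I := fun k s' =>
  [/\ scanned N d s s', in_run s' (ireg s' 4)
    & (n <= k + 41 * ireg s' 4 + 33 * last_cut s')%N]) _ _); last first.
  by split=> //; [left; lia|rewrite p1; lia].
move=> k s' [sc run kn]; have [fr [e7 e6] pN ch pre] := sc.
have [e1 e2 eqa eqr0] := fr.
have e_ix : iarr s' 0 = iarr s 0 by apply: eqa.
have e_rw : iarr s' 1 = iarr s 1 by apply: eqa.
have e_cl : iarr s' 2 = iarr s 2 by apply: eqa.
split=> //=; first lia; rewrite e2 => ltp; last first.
  apply: post => //; [lia|lia|].
  have [le|run'] := run; first lia.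
  have eN : ireg s' 4 = N by lia.
  rewrite eN in run'.
  have [le|lt] := leqP N (last_cut s' + d * d); first lia.
  by have := layout_run lay (p := (last_cut s' + d * d - 1)%N)
    (q := (N - 1)%N); lia.
have flp := flat_lt lay ltp.
have rwp := layout_row lay ltp; have clp := layout_col lay ltp.
(* The 23 credits are reserved for adding the entry (19) and the increment (4). *)
apply/wp_seq/(wp_mono (Q := fun k' s2 =>
  [/\ scanned N d s s2, ireg s2 4 = ireg s' 4, in_run s2 (ireg s' 4).+1
    & (n + 23 <= k' + 41 * (ireg s' 4).+1 + 33 * last_cut s2)%N])).
  move=> k2 s2 [sc2 e4 run2 kn2].
  have [[e12 e22 eqa2 eqr02] [e72 e62] pN2 ch2 pre2] := sc2.
  have e_ix2 : iarr s2 0 = iarr s 0 by apply: eqa2.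
  have e_rw2 : iarr s2 1 = iarr s 1 by apply: eqa2.
  have e_cl2 : iarr s2 2 = iarr s 2 by apply: eqa2.
  have fits : ifits W s2 entry_pos.
    rewrite /= e_rw2 e_cl2 e12 e4; move: flp; rewrite /flat => flp.
    by split=> //; [split=> //; lia|lia].
  have lc : (last_cut s2 <= N)%N by lia.
  apply/wp_seq/wp_rarr => //.
    by rewrite /=; lia.
  apply: wp_ireg => /=; first by split=> //; lia.
    by lia.
  have ev : (iarr s2 1 (ireg s2 4) * ireg s2 1 + iarr s2 2 (ireg s2 4))%N =
      flat d (iarr s 1) (iarr s 2) (ireg s2 4).
    by rewrite e_rw2 e_cl2 e12.
  split; last by rewrite /last_cut /= in kn2 *; lia.
    split=> //=.
    + by rewrite /last_cut /= in lc *; rewrite /last_cut in pN2; lia.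
    + move=> q lt; rewrite addn1 prefix_entryS ev eqr02.
      by case: eqP => [->|_]; rewrite ?addr0 pre2 // e4.
  by rewrite /in_run /last_cut /= e4 addn1.
apply: wp_if => /=.
- by split=> //; split=> //; split=> //; lia.
- lia.
- rewrite e_ix e6 -leqNgt => /andP[le_p jump].
  have p0 : (0 < ireg s' 4)%N by lia.
  apply: (@wp_cut_here _ _ N d _ _ s) => //.
  + exact: aligned_jump lay p0 jump.
  + have [le|run'] := run; first lia.
    by have := layout_run lay (p := (last_cut s' + d * d - 1)%N)
      (q := (ireg s' 4 - 1)%N); lia.
  + lia.
  move=> k2 s2 kn2 sc2 lc2 e42; split=> //; last lia.
  by left; rewrite lc2; lia.
rewrite e_ix e6 => stay; apply: wp_skip; first lia.
split=> //; last by lia.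
have [lt|ge] := ltnP (ireg s' 4) (last_cut s' + d * d); first by left.
right; have -> : ((ireg s' 4).+1 - 1 = ireg s' 4)%N by lia.
move: stay; rewrite -leqNgt ge /= -leqNgt => ge_ix.
have mono x : (x <= ireg s' 4)%N -> (iarr s 0 x <= iarr s 0 (ireg s' 4))%N.
  by move=> lx; apply: (layout_mono lay); lia.
have eq_ix : iarr s 0 (ireg s' 4 - 1)%N = iarr s 0 (ireg s' 4).
  by have := mono (ireg s' 4 - 1)%N; lia.
(* In the first case [ireg s' 4] is exactly [last_cut s' + d * d], and the run starts here. *)
have [le|run'] := run; last by rewrite run'.
by have -> : (last_cut s' + d * d - 1 = ireg s' 4 - 1)%N by lia.
Qed.

(** The sentinel [N] after the last cut lets every chunk, including the last, be delimited by two
    consecutive cuts. *)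
Definition ready (R : realType) (N d : nat) (s : state R) : Prop :=
  [/\ ireg s 1 = d, ireg s 2 = N, state_chunked N d s,
      iarr s 3 (ireg s 3) = N
    & (last_cut s <= N <= last_cut s + 2 * (d * d))%N].

(** Zeroing [d * d] cells is charged to the entries, as it happens only when [N >= d * d]: hence 85,
    with 74 for the scan and 11 for the zeroing. *)
Lemma wp_init_prog (R : realType) W N d n (s : state R) :
  layout N d (iarr s 0) (iarr s 1) (iarr s 2) ->
  (2 * N + 3 * (d * d) + 3 <= W)%N ->
  ireg s 1 = d -> ireg s 2 = N -> (85 * N + 40 <= n)%N ->
  wp W init_prog (fun _ s' =>
    [/\ ready N d s', agree_off 3 (iarr s') (iarr s) & rarr s' 0 = rarr s 0])
    n s.
Proof.
move=> lay leW e1 e2 le_n.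
apply/wp_seq/wp_ireg => /=; first by rewrite e1; split=> //; lia.
  lia.
apply/wp_seq/wp_iarr => //=; first lia.
apply/wp_seq/wp_ireg => //=; [lia|lia|].
apply/wp_seq/(wp_mono (Q := fun k s' =>
  [/\ input_frame N d s s', state_chunked N d s',
      (last_cut s' <= N <= last_cut s' + 2 * (d * d))%N & (3 < k)%N])).
  move=> k s' [[e1' e2' eqa eqr0] ch lastN k3].
  have K0 := chunked_gt0 ch.
  have e_last : last_cut (set_iarr s' 3 (ireg s' 3) N) = last_cut s'.
    by rewrite /last_cut /= (_ : _ == _ = false) //; lia.
  apply: wp_iarr => //=; first lia.
  rewrite e2'; split=> //; last exact: agree_off_upd.
  split=> //.
  - exact: chunked_extend.
  - by rewrite /= eqxx.
  - by rewrite e_last.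
(* With the single cut 0 no block is constrained, so [P] is arbitrary. This is the final state if
   [N < d * d] and the start of the scan otherwise. *)
have ch1 P : chunked N (d * d) (iarr s 0) (flat d (iarr s 1) (iarr s 2))
    (rarr s 0) 1 (upd (iarr s 3) 0 0) P.
  split=> //.
  - by case=> // _; apply: aligned0.
  - by case.
  - by case.
set s1 := set_ireg _ 3 1.
have fr1 : input_frame N d s s1.
  by split=> //=; apply: agree_off_upd.
apply: wp_if => //=.
- lia.
- rewrite e2 e1 => ltN; apply: wp_skip; first lia.
  split=> //.
  + by rewrite /last_cut /=; lia.
  + lia.
rewrite e2 e1 -leqNgt => leN.
have e7 : ireg s1 7 = (d * d)%N by rewrite /= e1.
apply/wp_seq/wp_zero_prefix; rewrite ?e7; [lia|lia|].
move=> k2 s2 kn2 eqi ea er z.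
apply/wp_seq/wp_ireg => //=; first lia.
apply/wp_seq/wp_ireg => //=; first lia.
have ei x : (x < 4)%N -> ireg s2 x = ireg s1 x.
  by move=> lt; apply: eqi; apply/eqP; lia.
have last0 x v y w :
    last_cut (set_ireg (set_ireg s2 x.+4 v) y.+4 w) = 0%N.
  by rewrite /last_cut /= ea (ei 3%N).
have e72 : ireg s2 7 = (d * d)%N by rewrite eqi.
apply: (@wp_scan _ _ N d _ _ s) => //.
- split=> //.
  + split=> /=; rewrite ?ei ?ea ?er //.
    exact: agree_off_upd.
  + by rewrite last0 /= e72.
  + by rewrite last0 /=.
  + rewrite /state_chunked /= ea (ei 3%N) // (er 0%N) //.
  + by move=> q lt; rewrite /= z // /prefix_entry big_geq.
- by rewrite /=; lia.
move=> k3 s3 kn3 [fr _ pN ch _] e4 leN3; split=> //; first lia.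
by move: kn3; rewrite /=; lia.
Qed.

(** * Search *)

Definition query_frame (R : realType) (s s' : state R) : Prop :=
  [/\ ireg s' 1 = ireg s 1, ireg s' 2 = ireg s 2, ireg s' 3 = ireg s 3,
      iarr s' = iarr s & rarr s' = rarr s].

Lemma ready_frame (R : realType) N d (s s' : state R) :
  query_frame s s' -> ready N d s -> ready N d s'.
Proof.
case: s s' => [? ? ? ?] [? ? ? ?] [/= e1 e2 e3 -> ->].
by rewrite /ready /state_chunked /last_cut /= e1 e2 e3.
Qed.

(** The function F of the overview, in sparse form, for the query matrix in real array 1. *)
Definition prefix_value (R : realType) (s : state R) (d p : nat) : R :=
  \sum_(0 <= x < p)
    rarr s 0 x * rarr s 1 (flat d (iarr s 1) (iarr s 2) x).

Lemma ready_cut (R : realType) N d (s : state R) k :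
  ready N d s -> (k <= ireg s 3)%N ->
  aligned N (iarr s 0) (iarr s 3 k) /\ (iarr s 3 k <= N)%N.
Proof.
case=> _ _ ch eN _; rewrite leq_eqVlt => /orP[/eqP ->|lt].
  by rewrite eN; split=> //; apply: aligned_end.
by split; [apply: (chunked_aligned ch)|apply: (chunked_le ch)].
Qed.

Lemma ready_chunk (R : realType) N d (s : state R) k :
  ready N d s -> (k < ireg s 3)%N ->
  (iarr s 3 k <= iarr s 3 k.+1 <= iarr s 3 k + 2 * (d * d))%N.
Proof.
case=> _ _ ch eN last lt; have [e|ne] := eqVneq k.+1 (ireg s 3).
  by move: last; rewrite /last_cut -e /= e eN.
by apply: (chunked_size ch); lia.
Qed.

Lemma wp_bisect (R : realType) W N d j Q n (s : state R) :
  layout N d (iarr s 0) (iarr s 1) (iarr s 2) ->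
  (2 * N + 3 * (d * d) + 3 <= W)%N -> (0 < d)%N ->
  ready N d s -> ireg s 7 = (d * d)%N ->
  ireg s 8 = 0%N -> ireg s 9 = ireg s 3 -> rreg s 1 = 0 ->
  0 < prefix_value s d N ->
  (ireg s 3 <= 2 ^ j)%N -> (48 * (d * d) * j + 6 <= n)%N ->
  (forall k s', (n <= k + 48 * (d * d) * j + 6)%N ->
     query_frame s s' -> ireg s' 9 = (ireg s' 8).+1 ->
     (ireg s' 8 < ireg s 3)%N ->
     prefix_value s d (iarr s 3 (ireg s' 8)) <
       prefix_value s d (iarr s 3 (ireg s' 9)) -> Q k s') ->
  wp W bisect Q n s.
Proof.
move=> lay leW d0 rdy e7 e8 e9 f0 F0 lej le_n post.
have [_ _ ch eN lastN] := rdy.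
have K0 := chunked_gt0 ch.
have leK : (ireg s 3 <= N + 1)%N.
  by have := chunked_sparse ch; rewrite -/(last_cut s); nia.
(* [i] bounds the halvings still to come. One costs at most [20 * (d * d) + 28 <= 48 * (d * d)], and
   the last test costs 6. *)
refine (wp_while (I := fun k s' =>
  [/\ query_frame s s' /\ ireg s' 7 = (d * d)%N,
      (ireg s' 8 < ireg s' 9 <= ireg s 3)%N,
      rreg s' 1 = prefix_value s d (iarr s 3 (ireg s' 8)),
      prefix_value s d (iarr s 3 (ireg s' 8)) <
        prefix_value s d (iarr s 3 (ireg s' 9))
    & exists2 i, (ireg s' 9 - ireg s' 8 <= 2 ^ i)%N &
        (n + 48 * (d * d) * i <= k + 48 * (d * d) * j /\
         48 * (d * d) * i + 6 <= k)%N]) _ _); last first.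
  have b0 := chunked_start ch.
  split; rewrite ?e8 ?e9 ?b0 //.
  - by lia.
  - by rewrite f0 /prefix_value big_geq.
  - by rewrite eN {1}/prefix_value big_geq.
  - by exists j; [rewrite subn0|split].
move=> k s' [[fr e7'] lr f1 Flt [i lei [kn kn']]].
have [e1 e2 e3 ea er] := fr.
split=> //=; [by split=> //; split=> //; lia|lia| |]; last first.
  move=> stop; apply: post => //; [nia|lia|lia].
move=> lt_lr.
have i0 : (0 < i)%N by case: i lei {kn kn'} => //; rewrite expn0; lia.
have dd0 : (0 < d * d)%N by nia.
have ei : (48 * (d * d) * i = 48 * (d * d) * i.-1 + 48 * (d * d))%N by nia.
have ep : (2 ^ i = 2 ^ i.-1 + 2 ^ i.-1)%N.
  by case: i i0 {lei kn kn' ei} => // i _; rewrite expnS /=; lia.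
set mid := ((ireg s' 8 + ireg s' 9) %/ 2)%N.
have mid_lr : (ireg s' 8 < mid < ireg s' 9)%N by rewrite /mid; lia.
have midD : (mid * (d * d) + d * d < W)%N.
  have := chunked_sparse ch; rewrite -/(last_cut s).
  have : (mid <= (ireg s 3).-1)%N by lia.
  by nia.
apply/wp_seq/wp_ireg => /=.
- by split=> //; [split=> //; lia|lia|rewrite -/mid; nia].
- lia.
apply/wp_seq/wp_eval_prefix; rewrite /= -/mid e7' //; first lia.
move=> k2 s2 kn2 eqi ea2 er2 eqr acc.
have eqi' x : (x != 5%N) && (x != 10%N) -> ireg s2 x = ireg s' x.
  by case/andP=> ne5 ne10; rewrite eqi //= (negbTE ne10).
have e10 : ireg s2 10 = mid by rewrite eqi.
have accE : rreg s2 0 = prefix_value s d (iarr s 3 mid).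
  have flatD x : (x < iarr s 3 mid)%N ->
      (flat d (iarr s 1) (iarr s 2) x < d * d)%N.
    by move=> ltx; apply: (flat_lt lay); have := chunked_le ch (k := mid); lia.
  rewrite acc er /prefix_value -(prefix_entry_dot _ _ flatD).
  apply: eq_big_nat => q /andP[_ ltq].
  (* [mid] lies strictly between the two cuts, so neither the unset block 0 nor a block for the
     sentinel is ever read. *)
  by rewrite (chunked_prefix ch) //; lia.
have fr2 : query_frame s s2.
  by split; rewrite ?eqi' // ?ea2 ?er2.
have r1 : rreg s2 1 = rreg s' 1 by rewrite eqr.
have lei1 : (mid - ireg s' 8 <= 2 ^ i.-1)%N by rewrite /mid; lia.
have lei2 : (ireg s' 9 - mid <= 2 ^ i.-1)%N by rewrite /mid; lia.
apply: wp_if => //=.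
- lia.
- rewrite accE r1 f1 => lt.
  apply: wp_ireg => //=; first lia.
  rewrite e10 (eqi' 8%N) // (eqi' 7%N) // r1; split=> //; first lia.
  by exists i.-1 => //; lia.
rewrite accE r1 f1 -leNgt => le.
apply/wp_seq/wp_ireg => //=; first lia.
apply: wp_rreg => //=; first lia.
rewrite e10 (eqi' 9%N) // (eqi' 7%N) //; split=> //; first lia.
  exact: le_lt_trans le Flt.
by exists i.-1 => //; lia.
Qed.

(** [good] abstracts the property of having a positive inner product. The increase of F over the
    chunk is the sum of its increases over the matrices inside, so one of these is positive. An
    entry costs at most 46, and a chunk has at most [2 * (d * d)] entries. *)
Lemma wp_search (R : realType) W N d Q n (s : state R) (good : nat -> Prop) :
  layout N d (iarr s 0) (iarr s 1) (iarr s 2) ->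
  (2 * N + 3 * (d * d) + 3 <= W)%N ->
  ready N d s -> (ireg s 8 < ireg s 3)%N -> ireg s 9 = (ireg s 8).+1 ->
  prefix_value s d (iarr s 3 (ireg s 8)) <
    prefix_value s d (iarr s 3 (ireg s 9)) ->
  (forall p q, aligned N (iarr s 0) p -> aligned N (iarr s 0) q ->
     (p < q <= N)%N -> iarr s 0 p = iarr s 0 (q - 1)%N ->
     prefix_value s d p < prefix_value s d q -> good (iarr s 0 p)) ->
  (92 * (d * d) + 12 <= n)%N ->
  (forall k s', query_frame s s' -> good (ireg s' 0) -> Q k s') ->
  wp W search Q n s.
Proof.
move=> lay leW rdy lt8 e9 Flt goodP le_n post.
have sz := ready_chunk rdy lt8; rewrite -e9 in sz.
have [al8 le8] := ready_cut rdy (ltnW lt8).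
have [al9 le9] : aligned N (iarr s 0) (iarr s 3 (ireg s 9)) /\
    (iarr s 3 (ireg s 9) <= N)%N by apply: (ready_cut rdy); lia.
have [r1 _ _ _ _] := rdy.
set b := iarr s 3 (ireg s 8) in sz al8 le8 Flt *.
set b' := iarr s 3 (ireg s 9) in sz al9 le9 Flt *.
apply/wp_seq/wp_ireg => //=; first lia.
apply/wp_seq/wp_ireg => //=; first lia.
apply/wp_seq/wp_rreg => //=; first lia.
refine (wp_while (I := fun k s' =>
  [/\ query_frame s s' /\ ireg s' 5 = b',
      (ireg s' 4 <= b')%N,
      (n + 46 * b <= k + 46 * ireg s' 4 + 8)%N
    & exists st, [/\ (b <= st <= ireg s' 4)%N, aligned N (iarr s 0) st,
        if (ireg s' 4 < b')%N then iarr s 0 st = iarr s 0 (ireg s' 4)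
        else st = ireg s' 4,
        rreg s' 0 = prefix_value s d (ireg s' 4) - prefix_value s d st
      & good (ireg s' 0) \/ prefix_value s d st < prefix_value s d b']])
  _ _); last first.
  split=> //=; [by rewrite -/b; lia|by rewrite -/b; lia|].
  exists b; split=> //.
  - by rewrite -/b; lia.
  - by rewrite -/b; case: ltnP.
  - by rewrite -/b subrr.
  - by right.
move=> k s' [[fr e5] p_le kn [st [stp al st_ix acc found]]].
have [e1 e2 e3 ea er] := fr.
split=> //=; first lia; rewrite e5; last first.
  move=> stop; apply: post => //.
  move: st_ix; rewrite (negbTE stop) => st_p.
  case: found => // lt; move: lt.
  have -> : st = b' by lia.
  by rewrite ltxx.
move=> lt_p; rewrite lt_p in st_ix.
have lt_pN : (ireg s' 4 < N)%N by lia.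
have flp := flat_lt lay lt_pN.
have rwp := layout_row lay lt_pN; have clp := layout_col lay lt_pN.
apply/wp_seq/wp_rreg => /=.
- rewrite ea e1 r1; move: flp; rewrite /flat => flp.
  by split=> //; split=> //; split=> //; [split=> //; lia|lia].
- lia.
apply/wp_seq/wp_ireg => /=; first by split=> //; lia.
  lia.
have acc' : rreg s' 0 +
    rarr s' 0 (ireg s' 4) *
      rarr s' 1 (iarr s' 1 (ireg s' 4) * ireg s' 1 + iarr s' 2 (ireg s' 4))%N =
    prefix_value s d (ireg s' 4).+1 - prefix_value s d st.
  by rewrite acc er ea e1 r1 /prefix_value big_nat_recr //= addrAC.
rewrite acc'; set p := (ireg s' 4 + 1)%N.
have pE : p = (ireg s' 4).+1 by rewrite /p addn1.
have pB : (p - 1 = ireg s' 4)%N by lia.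
apply: wp_if => /=; rewrite ?ea ?e5.
- by split=> //; split=> //; split=> //; lia.
- lia.
- rewrite -/p pB -leqNgt => /andP[lt_pb' same].
  have same_ix : iarr s 0 p = iarr s 0 (ireg s' 4).
    have := layout_mono lay (p := ireg s' 4) (q := p).
    by lia.
  apply: wp_skip => /=; first lia.
  split=> //=; [lia|lia|].
  exists st; split=> //; rewrite -?pE //.
  - by rewrite -/p; lia.
  - by rewrite lt_pb' st_ix.
rewrite -/p pB => stop.
(* At [p = b'] the test may have read past the chunk; there alignment comes from the cut itself. *)
have alp : aligned N (iarr s 0) p.
  have [lt_pb'|ge_pb'] := ltnP p b'; last first.
    by have -> : p = b' by lia.
  apply: (aligned_jump lay); first lia.
  by move: stop; rewrite pB lt_pb' /= negbK.
apply/wp_seq/wp_if => //=; first lia.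
  rewrite -pE subr_gt0 => Fst.
  apply: wp_ireg => /=; first by split=> //; lia.
    lia.
  apply: wp_rreg => //=; first lia.
  split=> //=; [lia|lia|].
  rewrite ea -/p pB.
  exists p; split=> //.
  - by lia.
  - by case: ltnP.
  - by rewrite subrr.
  left; rewrite -st_ix; apply: goodP Fst => //; first lia.
  by rewrite pB.
rewrite -pE subr_gt0 -leNgt => Fst.
apply: wp_skip; first lia.
apply: wp_rreg => //=; first lia.
split=> //=; [lia|lia|].
exists p; split=> //.
- by rewrite -/p; lia.
- by rewrite -/p; case: ltnP.
- by rewrite -/p subrr.
by case: found => [|lt]; [left|right; apply: le_lt_trans Fst lt].
Qed.

Lemma wp_query_prog (R : realType) W N d j n (s : state R)
    (good : nat -> Prop) :
  layout N d (iarr s 0) (iarr s 1) (iarr s 2) ->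
  (2 * N + 3 * (d * d) + 3 <= W)%N -> (0 < d)%N -> ready N d s ->
  0 < prefix_value s d N -> (ireg s 3 <= 2 ^ j)%N ->
  (forall p q, aligned N (iarr s 0) p -> aligned N (iarr s 0) q ->
     (p < q <= N)%N -> iarr s 0 p = iarr s 0 (q - 1)%N ->
     prefix_value s d p < prefix_value s d q -> good (iarr s 0 p)) ->
  (48 * (d * d) * j + 92 * (d * d) + 28 <= n)%N ->
  wp W query_prog (fun _ s' => query_frame s s' /\ good (ireg s' 0)) n s.
Proof.
move=> lay leW d0 rdy F0 lej goodP le_n.
have [e1 e2 _ _ _] := rdy.
apply/wp_seq/wp_ireg => /=; first by rewrite e1; split=> //; lia.
  lia.
apply/wp_seq/wp_ireg => //=; first lia.
apply/wp_seq/wp_ireg => //=; first lia.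
apply/wp_seq/wp_rreg => //=; first lia.
apply/wp_seq/(@wp_bisect _ _ N d j) => //=.
- by rewrite e1.
- lia.
move=> k s' kn fr e9 lt8 Flt.
have [_ _ e3 ea er] := fr; rewrite /= in e3 ea er.
have pvE p : prefix_value s' d p = prefix_value s d p.
  by rewrite /prefix_value ea er.
apply: (@wp_search _ _ N d _ _ _ good) => //.
- by rewrite ea.
- exact: ready_frame fr _.
- by rewrite e3.
- by rewrite ea !pvE.
- by move=> p q; rewrite ea !pvE; apply: goodP.
- lia.
move=> k2 s2 fr2 found; split=> //.
case: fr => /= ? ? ? ? ?; case: fr2 => /= ? ? ? ? ?.
by split; congruence.
Qed.

(** * Sparse representations *)

(** The part of [init_input] that survives a query, whose answer overwrites register 0. *)
Definition input_arrays (R : realType) (m d : nat) (M : 'I_m -> 'M[R]_d)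
    (es : seq ('I_m * ('I_d * 'I_d))) (s : state R) : Prop :=
  [/\ mkseq (iarr s 0) (size es) = [seq nat_of_ord x.1 | x <- es],
      mkseq (iarr s 1) (size es) = [seq nat_of_ord x.2.1 | x <- es],
      mkseq (iarr s 2) (size es) = [seq nat_of_ord x.2.2 | x <- es]
    & mkseq (rarr s 0) (size es) = [seq M x.1 x.2.1 x.2.2 | x <- es]].

Lemma mkseq_eq_map (T U : Type) (x0 : U) (f : nat -> T) (g : U -> T)
    (s : seq U) p :
  mkseq f (size s) = [seq g x | x <- s] -> (p < size s)%N ->
  f p = g (nth x0 s p).
Proof.
move=> e lt; rewrite -(nth_mkseq (f 0) f lt) e; exact: nth_map.
Qed.

Section Sparse.
Variables (R : realType) (m d : nat) (M : 'I_m -> 'M[R]_d).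
Variables (es : seq ('I_m * ('I_d * 'I_d))) (s : state R).
Hypotheses (repr : sparse_repr M es) (inp : input_arrays M es s).

Lemma size_sparse : size es = (\sum_(i < m) nnz (M i))%N.
Proof.
have [uq mem _] := repr.
rewrite -(card_uniqP uq) -sum1_card.
under [RHS]eq_bigr => i _ do rewrite /nnz -sum1_card.
rewrite pair_big_dep /=; apply: eq_bigl => x.
by rewrite mem inE.
Qed.

(** Together with the sparsity of the cuts this bounds their number by [m.+1], the source of the
    factor [log m]. *)
Lemma size_sparse_le : (size es <= m * (d * d))%N.
Proof.
have [uq _ _] := repr.
by rewrite -(card_uniqP uq) (leq_trans (max_card _)) // !card_prod !card_ord.
Qed.

Lemma layout_sparse :
  layout (size es) d (iarr s 0) (iarr s 1) (iarr s 2).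
Proof.
have [uq _ srt] := repr; have [ixE rwE clE _] := inp.
case: es uq srt ixE rwE clE => [|x0 l]; first by split=> /= [p q|p|p|p q]; lia.
set es' := x0 :: l => uq srt ixE rwE clE.
have {}ixE p := mkseq_eq_map x0 (p := p) ixE.
have {}rwE p := mkseq_eq_map x0 (p := p) rwE.
have {}clE p := mkseq_eq_map x0 (p := p) clE.
clearbody es'.
have mono p q : (p <= q < size es')%N -> (iarr s 0 p <= iarr s 0 q)%N.
  move=> pq; rewrite !ixE; [|lia|lia].
  apply: (sorted_leq_nth _ _ x0 srt); rewrite ?inE; try lia.
  - by move=> y x z; apply: leq_trans.
  - by move=> x; apply: leqnn.
split=> // [p lt|p lt|p q pq eq_ix].
- by rewrite rwE.
- by rewrite clE.
(* All entries from [p] to [q] lie in one matrix, so their positions are distinct, and only [d * d]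
   positions exist. *)
pose run := [seq x.2 | x <- take (q - p).+1 (drop p es')].
have size_run : size run = (q - p).+1.
  by rewrite size_map size_take size_drop; case: ltnP; lia.
have ix_run x : x \in take (q - p).+1 (drop p es') ->
    nat_of_ord x.1 = iarr s 0 p.
  move=> /(nthP x0) [k]; rewrite size_take size_drop => ltk <-.
  have {}ltk : (k < (q - p).+1)%N by apply: leq_trans ltk _; case: ltnP; lia.
  rewrite nth_take // nth_drop -ixE; last by lia.
  have := mono p (p + k)%N; have := mono (p + k)%N q.
  by lia.
have uq_run : uniq run.
  rewrite map_inj_in_uniq ?take_uniq ?drop_uniq //.
  move=> [i x] [i' x'] /ix_run /= e /ix_run /= e' eqx.
  by congr pair => //; apply: val_inj; rewrite /= e e'.
have := max_card (mem run); rewrite (card_uniqP uq_run) size_run.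
by rewrite card_prod card_ord.
Qed.

Variable A : 'M[R]_d.
Hypothesis dense : forall j k : 'I_d, rarr s 1 (j * d + k)%N = A j k.

Let term p := rarr s 0 p * rarr s 1 (flat d (iarr s 1) (iarr s 2) p).

Lemma mxinner_sparse (i : 'I_m) :
  mxinner (M i) A = \sum_(0 <= p < size es | iarr s 0 p == i) term p.
Proof.
have [uq mem _] := repr; have [ixE rwE clE vlE] := inp.
(* Unlisted entries are zero, so the trace, expanded over all triples, restricts to the list. *)
transitivity (\sum_(x <- es | x.1 == i) M x.1 x.2.1 x.2.2 * A x.2.1 x.2.2).
  rewrite big_mkcond big_uniq //= big_mkcond.
  pose g (i' : 'I_m) (p : 'I_d * 'I_d) :=
    if i' == i then M i' p.1 p.2 * A p.1 p.2 else 0.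
  transitivity (\sum_i' \sum_p g i' p).
    rewrite (bigD1 i) //= [X in _ + X]big1 ?addr0; last first.
      by move=> i' ne; rewrite big1 // => p _; rewrite /g (negbTE ne).
    rewrite /mxinner /mxtrace.
    under [LHS]eq_bigr => k _ do rewrite mxE.
    rewrite exchange_big /= pair_big /=; apply: eq_bigr => p _.
    by rewrite /g eqxx mxE.
  rewrite pair_big /=; apply: eq_bigr => x _; rewrite /g mem.
  have [//|nz] := boolP (M x.1 x.2.1 x.2.2 != 0).
  by rewrite (eqP (negPn nz)) mul0r if_same.
case: es uq mem ixE rwE clE vlE => [|x0 l]; first by rewrite !big_nil.
set es' := x0 :: l => uq mem ixE rwE clE vlE.
rewrite (big_nth x0) big_nat_cond [RHS]big_nat_cond; apply: eq_big => [p|p].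
  have [lt|//] := ltnP p (size es').
  by rewrite (mkseq_eq_map x0 ixE).
case/andP=> /andP[_ lt] _; rewrite /term /flat.
rewrite (mkseq_eq_map x0 rwE) // (mkseq_eq_map x0 clE) //.
by rewrite (mkseq_eq_map x0 vlE) // dense.
Qed.

Lemma sum_mxinner_sparse :
  \sum_(i < m) mxinner (M i) A = prefix_value s d (size es).
Proof.
under eq_bigr => i _ do rewrite mxinner_sparse big_mkcond.
rewrite exchange_big /= /prefix_value big_nat_cond [RHS]big_nat_cond.
apply: eq_bigr => p /andP[/andP[_ lt] _].
have [ixE _ _ _] := inp.
case: es lt ixE => // x0 l lt ixE; rewrite (mkseq_eq_map x0 ixE) //.
rewrite (bigD1 (nth x0 (x0 :: l) p).1) //= eqxx big1 ?addr0 // => i ne.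
by case: eqP => // /val_inj e; rewrite e eqxx in ne.
Qed.

(** Monotonicity gives all entries from [p] to [q - 1] the same index, and alignment at both ends
    excludes that index elsewhere: the interval is one whole matrix. *)
Lemma prefix_value_run p q :
  aligned (size es) (iarr s 0) p -> aligned (size es) (iarr s 0) q ->
  (p < q <= size es)%N -> iarr s 0 p = iarr s 0 (q - 1)%N ->
  exists i : 'I_m, iarr s 0 p = i /\
    mxinner (M i) A = prefix_value s d q - prefix_value s d p.
Proof.
move=> alp alq pq eq_ix; have [ixE _ _ _] := inp.
have [i ip] : exists i : 'I_m, iarr s 0 p = i.
  case: es pq ixE => [|x0 l] pq ixE; first by move: pq => /=; lia.
  by exists (nth x0 (x0 :: l) p).1; apply: (mkseq_eq_map x0 ixE); lia.
exists i; split=> //; rewrite mxinner_sparse.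
have lay := layout_sparse.
rewrite (big_cat_nat _ (n := p)) //=; last by lia.
rewrite [X in _ + X](big_cat_nat _ (n := q)) //=; try lia.
rewrite [X in X + _]big1_seq ?add0r; last first.
  move=> x /andP[/eqP e]; rewrite mem_index_iota => /andP[_ lt].
  by have := alp x p; lia.
rewrite [X in _ + X]big1_seq ?addr0; last first.
  move=> x /andP[/eqP e]; rewrite mem_index_iota => xq.
  by have := alq (q - 1)%N x; lia.
rewrite /prefix_value [X in _ = X - _](big_cat_nat _ (n := p)) //=; last by lia.
rewrite addrAC subrr add0r.
rewrite big_nat_cond [RHS]big_nat_cond; apply: eq_bigl => x.
rewrite andbT; case: ltnP => //= le_px; case: ltnP => //= ltq.
have := layout_mono lay (p := p) (q := x).
have := layout_mono lay (p := x) (q := (q - 1)%N).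
by rewrite -ip; lia.
Qed.

End Sparse.

(** * Word size and the final time bounds *)

Lemma word_capacity m d N W :
  ((m + d + N + 2) ^ 4 <= W)%N -> (2 * N + 3 * (d * d) + 3 <= W)%N.
Proof.
move=> le_W; apply: leq_trans le_W; rewrite -[4%N]/(2 * 2)%N expnM.
(* The square is at least 4, so squaring again gains a factor 4, which covers the constants 2 and
   3. *)
have le_sq : (d * d + N * 4 + 4 <= (m + d + N + 2) ^ 2)%N.
  by rewrite -mulnn; nia.
by move: le_sq; set x := (_ ^ 2)%N; rewrite -mulnn; nia.
Qed.

Theorem theorem5p1 (R : realType) :
  exists (init query : cmd) (C c : nat),
  forall (m d : nat) (M : 'I_m -> 'M[R]_d) (W : nat),
  let N := (\sum_(i < m) nnz (M i))%N in
  ((m + d + N + 2) ^ c <= W)%N ->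
  exists Inv : state R -> Prop,
    (forall (es : seq ('I_m * ('I_d * 'I_d))) (s : state R),
       sparse_repr M es -> init_input M es s ->
       exists (t : nat) (s' : state R),
         [/\ exec W init s t s', (t <= C * maxn 1 N)%N & Inv s'])
    /\
    (forall (A : 'M[R]_d) (s0 s : state R),
       Inv s0 -> query_input A s0 s ->
       0 < \sum_(i < m) mxinner (M i) A ->
       exists (t : nat) (s' : state R),
         [/\ exec W query s t s',
             (t <= C * (d ^ 2 * maxn 1 (trunc_log 2 m)))%N,
             Inv s'
           & exists i : 'I_m,
               query_output s' = i /\ 0 < mxinner (M i) A]).
Proof.
(* With [D = d * d] and [L] the logarithmic factor, both at least 1, the query costs
   [48 * D * L.+1 + 92 * D + 28], and [48 + 48 + 92 + 28 = 216]; preprocessing takes [85 + 40] at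
   most. *)
exists init_prog, query_prog, 216%N, 4%N => m d M W N /word_capacity leW.
(* The invariant is chosen before the list of entries is given, so it quantifies the list
   existentially. *)
exists (fun s => ready N d s /\
  exists2 es, sparse_repr M es & input_arrays M es s); split.
  move=> es s repr [[_ e1 e2] inp].
  have eN : size es = N by apply: size_sparse repr.
  have lay := layout_sparse repr inp; rewrite eN in lay e2.
  have [t [s' [ex le_t [rdy eqa eqr0]]]] :=
    wp_init_prog lay leW e1 e2 (leqnn _).
  exists t, s'; split=> //; first by lia.
  by split=> //; exists es => //; rewrite /input_arrays !eqa // eqr0.
move=> A s0 s [rdy0 [es repr inp0]] [ei er ea eqr dense] F0.
have inp : input_arrays M es s by rewrite /input_arrays ea eqr.
have eN : size es = N by apply: size_sparse repr.
have leN := size_sparse_le repr; rewrite eN in leN.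
have lay := layout_sparse repr inp; rewrite eN in lay.
have rdy : ready N d s.
  by move: rdy0; rewrite /ready /state_chunked /last_cut ei ea !eqr.
rewrite (sum_mxinner_sparse repr inp dense) eN in F0.
(* For [d = 0] there are no entries, and the promise fails. *)
have d0 : (0 < d)%N.
  rewrite lt0n; apply: contraTN F0 => /eqP d0.
  have -> : N = 0%N by move: leN; rewrite d0 !muln0 leqn0 => /eqP.
  by rewrite /prefix_value big_geq // ltxx.
set L := maxn 1 (trunc_log 2 m).
(* There are at most [m.+1] cuts, and [m < 2 ^ (trunc_log 2 m).+1]; hence the successor of [L]. *)
have leK : (ireg s 3 <= 2 ^ L.+1)%N.
  have [_ _ ch _ lastN] := rdy.
  have := chunked_sparse ch; rewrite -/(last_cut s) => spK.
  have leKm : (ireg s 3 <= m.+1)%N by nia.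
  apply: leq_trans leKm (leq_trans (trunc_log_ltn m (ltnSn 1)) _).
  by rewrite leq_exp2l // ltnS leq_maxr.
pose good (i : nat) := exists i' : 'I_m, i = i' /\ 0 < mxinner (M i') A.
have goodP p q : aligned N (iarr s 0) p -> aligned N (iarr s 0) q ->
    (p < q <= N)%N -> iarr s 0 p = iarr s 0 (q - 1)%N ->
    prefix_value s d p < prefix_value s d q -> good (iarr s 0 p).
  rewrite -eN => alp alq pq eq_ix ltF.
  have [i [ip inner]] := prefix_value_run repr inp dense alp alq pq eq_ix.
  by exists i; rewrite inner subr_gt0.
have [t [s' [ex le_t [fr found]]]] :=
  wp_query_prog lay leW d0 rdy F0 leK goodP (leqnn _).
exists t, s'; split=> //.
- apply: leq_trans le_t _; rewrite -mulnn.
  have L0 : (0 < L)%N by rewrite /L leq_max.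
  have dd0 : (0 < d * d)%N by rewrite muln_gt0 d0.
  have leDL := leq_pmulr (d * d) L0.
  by rewrite -mulnA mulnS; lia.
- split; first exact: ready_frame rdy.
  by exists es => //; case: fr => _ _ _ ea' er'; rewrite /input_arrays ea' er'.
Qed.
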